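(* Let $f$ be continuous on $Q=[a_1,b_1]\times\dots\times[a_n,b_n]$. For $x=(x^1,\dots,x^n)\in Q$ write $\tilde x^i=(x^1,\dots,x^{i-1},x^{i+1},\dots,x^n)$. Let $f_i[\tilde x^i]$ be the function $x^i\mapsto f(x^1,\dots,x^n)$ on $[a_i,b_i]$ with the other coordinates fixed. Let $H_1,\dots,H_n\in(0,1]$. (1) Suppose there are constants $c_i>0$ such that for all $i$, all $\tilde x^i$, all $x^i\in[a_i,b_i]$ and all sufficiently small $\delta>0$ one has $\mathrm{osc}_\delta(x^i)(f_i[\tilde x^i])\le c_i\delta^{H_i}$. Then the upper box-counting dimension of the graph of $f$ (a subset of $\mathbb R^{n+1}$) is at most $n+1-\min\{H_1,\dots,H_n\}$. (2) Suppose that for each $i$ there is a dense subset $A_i$ of $\prod_{j\ne i}[a_j,b_j]$ and a constant $c_i>0$ such that $\mathrm{Var}_\delta(f_i[\tilde x^i])\ge c_i\delta^{H_i}$ for all $\tilde x^i\in A_i$ and all sufficiently small $\delta>0$. Then the lower box-counting dimension of the graph of $f$ is at least $n+1-\min\{H_1,\dots,H_n\}$. (3) If the hypotheses of both (1) and (2) hold, then the box-counting dimension of the graph of $f$ exists and equals $n+1-\min\{H_1,\dots,H_n\}=n-1+\max\{s_1,\dots,s_n\}$, where $s_i=\sup_{\tilde x^i}\dim_B\mathrm{graph} f_i[\tilde x^i]$.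
   Context: For a continuous $g:[a,b]\to\mathbb R$ and $\delta>0$, the $\delta$-oscillation of $g$ at $x$ is $\mathrm{osc}_\delta(x)(g)=\sup\{|g(y)-g(z)|:y,z\in[a,b]\cap[x-\delta,x+\delta]\}$. The $\delta$-variation is $\mathrm{Var}_\delta(g)=\int_a^b\mathrm{osc}_\delta(x)(g)\,dx$. For a bounded $A\subset\mathbb R^d$, $N(\delta)$ is the number of cubes of the $\delta$-grid (products of intervals $[m_j\delta,(m_j+1)\delta]$, $m_j\in\mathbb Z$) meeting $A$. Upper and lower box-counting dimensions are $\limsup$ and $\liminf$ as $\delta\to0$ of $\ln N(\delta)/\ln(1/\delta)$, and $\dim_B$ denotes their common value when they agree. *)

(* Defs.v *)
From mathcomp Require Import all_boot all_order all_algebra finmap.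
From mathcomp Require Import all_classical all_reals all_analysis.
Import Order.TTheory GRing.Theory Num.Def Num.Theory.
Import numFieldNormedType.Exports.

Set Implicit Arguments.
Unset Strict Implicit.
Unset Printing Implicit Defensive.

Local Open Scope classical_set_scope.
Local Open Scope ring_scope.

Section BoxDim.
Context {R : realType}.

Definition osc (a b : R) (g : R -> R) (delta x : R) : R :=
  sup [set r | exists y z, [/\ a <= y <= b, x - delta <= y <= x + delta,
                               a <= z <= b, x - delta <= z <= x + delta &
                               r = `|g y - g z|]].

Definition Var (a b : R) (g : R -> R) (delta : R) : \bar R :=
  (\int[lebesgue_measure]_(x in `[a, b]) (osc a b g delta x)%:E)%E.

Definition grid_cubes (d : nat) (A : set 'rV[R]_d) (delta : R)
  : set {ffun 'I_d -> int} :=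
  [set m | exists2 y, A y &
     forall j, (m j)%:~R * delta <= y ord0 j <= (m j + 1)%:~R * delta].

(** N(delta) (A is bounded in all uses, so this set is finite) *)
Definition Ngrid (d : nat) (A : set 'rV[R]_d) (delta : R) : nat :=
  #|` fset_set (grid_cubes A delta)|%fset.

Definition box_ratio (d : nat) (A : set 'rV[R]_d) (delta : R) : R :=
  ln (Ngrid A delta)%:R / ln delta^-1.

Definition upper_box_dim (d : nat) (A : set 'rV[R]_d) : \bar R :=
  limf_esup (fun delta => (box_ratio A delta)%:E) 0^'+.

Definition lower_box_dim (d : nat) (A : set 'rV[R]_d) : \bar R :=
  limf_einf (fun delta => (box_ratio A delta)%:E) 0^'+.

Definition box_dim_exists (d : nat) (A : set 'rV[R]_d) : Prop :=
  upper_box_dim A = lower_box_dim A.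

Definition boxQ (n : nat) (a b : 'I_n -> R) : set 'rV[R]_n :=
  [set x | forall j, a j <= x ord0 j <= b j].

Definition boxQi (n : nat) (a b : 'I_n -> R) (i : 'I_n) : set 'rV[R]_n.-1 :=
  [set xt | forall k, a (lift i k) <= xt ord0 k <= b (lift i k)].

Definition ins (n : nat) (i : 'I_n) (xt : 'rV[R]_n.-1) (t : R) : 'rV[R]_n :=
  \row_j (match unlift i j with Some k => xt ord0 k | None => t end).

Definition fsec (n : nat) (f : 'rV[R]_n -> R) (i : 'I_n) (xt : 'rV[R]_n.-1)
  : R -> R := fun t => f (ins i xt t).

Definition graphQ (n : nat) (a b : 'I_n -> R) (f : 'rV[R]_n -> R)
  : set 'rV[R]_n.+1 :=
  [set p | boxQ a b (\row_j p ord0 (lift ord_max j)) /\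
           p ord0 ord_max = f (\row_j p ord0 (lift ord_max j))].

Definition graph1 (a b : R) (g : R -> R) : set 'rV[R]_2 :=
  [set p | a <= p ord0 ord0 <= b /\ p ord0 ord_max = g (p ord0 ord0)].

Definition dense_in (d : nat) (A P : set 'rV[R]_d) : Prop :=
  A `<=` P /\ P `<=` closure A.

Definition osc_upper_hyp (n : nat) (a b : 'I_n -> R) (f : 'rV[R]_n -> R)
  (H : 'I_n -> R) : Prop :=
  exists c : 'I_n -> R, (forall i, 0 < c i) /\
    exists2 delta0 : R, 0 < delta0 &
      forall i xt t delta, boxQi a b i xt -> a i <= t <= b i ->
        0 < delta < delta0 ->
        osc (a i) (b i) (fsec f i xt) delta t <= c i * delta `^ H i.

Definition var_lower_hyp (n : nat) (a b : 'I_n -> R) (f : 'rV[R]_n -> R)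
  (H : 'I_n -> R) : Prop :=
  forall i, exists A : set 'rV[R]_n.-1, dense_in A (boxQi a b i) /\
    exists2 c : R, 0 < c &
    exists2 delta0 : R, 0 < delta0 &
      forall xt delta, A xt -> 0 < delta < delta0 ->
        ((c * delta `^ H i)%:E <= Var (a i) (b i) (fsec f i xt) delta)%E.

Definition s_sec (n : nat) (a b : 'I_n -> R) (f : 'rV[R]_n -> R) (i : 'I_n)
  : \bar R :=
  ereal_sup [set upper_box_dim (graph1 (a i) (b i) (fsec f i xt)) | xt in
             [set xt | boxQi a b i xt /\
                       box_dim_exists (graph1 (a i) (b i) (fsec f i xt))]].

End BoxDim.

(* Main.v *)
Require Import Defs.
From mathcomp Require Import all_boot all_order all_algebra finmap.
From mathcomp Require Import all_classical all_reals all_analysis.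
From mathcomp Require Import measurable_realfun ring lra.

Set Implicit Arguments.
Unset Strict Implicit.
Unset Printing Implicit Defensive.

Import Order.TTheory GRing.Theory Num.Def Num.Theory.
Import numFieldNormedType.Exports.
Local Open Scope classical_set_scope.
Local Open Scope ring_scope.

(** Upper bound: two points of the box in a common grid cell are joined by
    changing one coordinate at a time, so [f] varies by [O(delta ^ minH)] on each
    of the [O(delta ^ -n)] cells and the column above a cell contains
    [O(delta ^ (minH - 1))] cubes of the graph.

    Lower bound: fix a direction [i]. In each of the [~ delta ^ -(n - 1)] cells of
    the transverse grid pick, by density, a section [g] of large
    [delta]-variation. By the intermediate value theorem, [osc g delta x] is at
    most [delta] times the number of cubes met by the graph of [g] whose [i]-th
    interval, enlarged by [delta] on both sides, contains [x]. Integrating in [x],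
    [Var g delta <= 3 * delta ^ 2 * #cubes], so every transverse cell contributes
    at least [c / 3 * delta ^ (H i - 2)] cubes.

    For the formula in terms of the sections, both bounds are applied to the
    sections themselves, seen as functions on one-dimensional boxes: the section
    dimension is [2 - H i] whenever the transverse point lies in the dense set. *)

(** Two members of a proper filter share a point, and the value of [u] there separates the infimum
    over one from the supremum over the other. *)
Lemma limf_einf_le_esup (R : realType) (T : choiceType)
    (X : filteredType T) (u : X -> \bar R) (F : set_system X) :
  ProperFilter F -> (limf_einf u F <= limf_esup u F)%E.
Proof.
move=> FF; rewrite limf_einfE limf_esupE.
apply: ge_ereal_sup => _ [V FV <-]; apply: le_ereal_inf_tmp => _ [W FW <-].
have [x [Vx Wx]] := filter_ex (filterI FV FW).
by apply: (@le_trans _ _ (u x));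
  [apply: ereal_inf_lbound | apply: ereal_sup_ubound]; exists x.
Qed.

(** * Dimension bounds from power-law bounds on cube counts *)

Section BoxDimensionBounds.
Context {R : realType}.
Implicit Types (s K e delta : R).

(** A constant factor [K] in a cube count thus costs at most [e] in the logarithmic ratio. *)
Lemma ln_inv_large K e : 0 < e ->
  \forall delta \near 0^'+, 0 < delta /\ 0 < ln delta^-1 /\
    `|ln K| <= e * ln delta^-1.
Proof.
move=> e0; near=> delta.
have d0 : 0 < delta by near: delta; exact: nbhs_right_gt.
(* The threshold solves [|ln K| <= e * ln delta^-1]; the extra [- 1] keeps [ln delta^-1] positive
   even when [ln K = 0]. *)
have : delta < expR (- (`|ln K| / e) - 1).
  by near: delta; apply: nbhs_right_lt; exact: expR_gt0.
move=> dlt; have : ln delta < - (`|ln K| / e) - 1.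
  by rewrite -[X in _ < X]expRK ltr_ln // posrE expR_gt0.
have q0 : 0 <= `|ln K| / e by rewrite divr_ge0 // ltW.
rewrite lnV ?posrE // => H; split => //; split; first by lra.
have -> : `|ln K| = e * (`|ln K| / e) by field; rewrite gt_eqF.
by rewrite ler_pM2l //; lra.
Unshelve. all: by end_near. Qed.

Lemma upper_box_dim_le d (A : set 'rV[R]_d) s K : 0 <= s -> 0 < K ->
  (\forall delta \near 0^'+, (Ngrid A delta)%:R <= K * delta `^ (- s)) ->
  (upper_box_dim A <= s%:E)%E.
Proof.
move=> s0 K0 N_le; apply/lee_addgt0Pr => e e0.
rewrite /upper_box_dim limf_esupE.
pose V := [set delta : R | box_ratio A delta <= s + e].
suff VF : (0^'+)%R V.
  apply: (@le_trans _ _ (ereal_sup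
    ((fun delta => (box_ratio A delta)%:E) @` V))).
    by apply: ereal_inf_lbound; exists V.
  by apply: ge_ereal_sup => _ [x Vx <-]; rewrite -EFinD lee_fin.
near=> delta.
have [d0 [l0 lK]] : 0 < delta /\ 0 < ln delta^-1 /\ `|ln K| <= e * ln delta^-1.
  by near: delta; exact: ln_inv_large.
have N_le' : (Ngrid A delta)%:R <= K * delta `^ (- s) by near: delta.
rewrite /V /= /box_ratio ler_pdivrMr // mulrDl.
have lK' := le_trans (ler_norm _) lK.
(* For a zero count the convention [ln 0 = 0] makes the ratio [0], and [0 <= s] settles the case. *)
have [->|N0] := eqVneq (Ngrid A delta) 0%N.
  by rewrite ln0 // addr_ge0 // mulr_ge0 // ltW.
have N0' : 0 < (Ngrid A delta)%:R :> R by rewrite ltr0n lt0n.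
apply: le_trans (_ : ln K + s * ln delta^-1 <= _); last by lra.
apply: le_trans (_ : ln (K * delta `^ (- s)) <= _).
  by rewrite ler_ln // posrE ?mulr_gt0 ?powR_gt0.
rewrite lnM ?posrE ?powR_gt0 // ln_powR lnV ?posrE //.
by rewrite mulrN mulNr.
Unshelve. all: by end_near. Qed.

Lemma lower_box_dim_ge d (A : set 'rV[R]_d) s K : 0 < K ->
  (\forall delta \near 0^'+, K * delta `^ (- s) <= (Ngrid A delta)%:R) ->
  (s%:E <= lower_box_dim A)%E.
Proof.
move=> K0 N_ge; apply/lee_subgt0Pr => e e0.
rewrite /lower_box_dim limf_einfE.
pose V := [set delta : R | s - e <= box_ratio A delta].
suff VF : (0^'+)%R V.
  apply: (@le_trans _ _ (ereal_inf
    ((fun delta => (box_ratio A delta)%:E) @` V))); last first.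
    by apply: ereal_sup_ubound; exists V.
  by apply: le_ereal_inf_tmp => _ [x Vx <-]; rewrite -EFinB lee_fin.
near=> delta.
have [d0 [l0 lK]] : 0 < delta /\ 0 < ln delta^-1 /\ `|ln K| <= e * ln delta^-1.
  by near: delta; exact: ln_inv_large.
have N_ge' : K * delta `^ (- s) <= (Ngrid A delta)%:R by near: delta.
rewrite /V /= /box_ratio ler_pdivlMr // mulrBl.
have lK' : - ln K <= e * ln delta^-1.
  by apply: le_trans lK; rewrite -normrN ler_norm.
have N0' : 0 < K * delta `^ (- s) by rewrite mulr_gt0 ?powR_gt0.
apply: le_trans (_ : ln K + s * ln delta^-1 <= _); first by lra.
apply: le_trans (_ : ln (K * delta `^ (- s)) <= _).
  by rewrite lnM ?posrE ?powR_gt0 // ln_powR lnV ?posrE // mulrN mulNr.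
by rewrite ler_ln // posrE (lt_le_trans N0').
Unshelve. all: by end_near. Qed.

End BoxDimensionBounds.

(** * Inserting one coordinate into points and grid indices *)

Section Insertion.
Context {R : realType}.

(** The counterpart of [ins] for the integer indices of grid cubes. *)
Definition ffun_ins (n : nat) (i : 'I_n) (m : {ffun 'I_n.-1 -> int}) (t : int)
  : {ffun 'I_n -> int} :=
  [ffun j => match unlift i j with Some k => m k | None => t end].

Lemma ffun_ins_lift n (i : 'I_n) m t k : ffun_ins i m t (lift i k) = m k.
Proof. by rewrite ffunE liftK. Qed.

Lemma ffun_ins_id n (i : 'I_n) m t : ffun_ins i m t i = t.
Proof. by rewrite ffunE unlift_none. Qed.

Lemma ffun_ins_eta n (i : 'I_n) (m : {ffun 'I_n -> int}) :
  ffun_ins i [ffun k => m (lift i k)] (m i) = m.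
Proof.
apply/ffunP => j; rewrite ffunE.
by case: unliftP => [k|] -> //; rewrite ffunE.
Qed.

Lemma ins_lift n (i : 'I_n) (x : 'rV[R]_n.-1) t k :
  ins i x t ord0 (lift i k) = x ord0 k.
Proof. by rewrite mxE liftK. Qed.

Lemma ins_id n (i : 'I_n) (x : 'rV[R]_n.-1) t : ins i x t ord0 i = t.
Proof. by rewrite mxE unlift_none. Qed.

Lemma ins_eta n (i : 'I_n) (x : 'rV[R]_n) :
  ins i (\row_k x ord0 (lift i k)) (x ord0 i) = x.
Proof.
apply/rowP => j; rewrite mxE.
by case: unliftP => [k|] -> //; rewrite mxE.
Qed.

Lemma boxQ_ins n (a b : 'I_n -> R) (i : 'I_n) x t :
  boxQi a b i x -> a i <= t <= b i -> boxQ a b (ins i x t).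
Proof.
by move=> xQ tab j; rewrite mxE; case: unliftP => [k|] ->.
Qed.

Lemma graphQ_ins n (a b : 'I_n -> R) f (x : 'rV[R]_n) :
  boxQ a b x -> graphQ a b f (ins (ord_max : 'I_n.+1) x (f x)).
Proof.
move=> xQ; rewrite /graphQ /=.
suff -> : \row_j ins (ord_max : 'I_n.+1) x (f x) ord0 (lift ord_max j) = x.
  by rewrite ins_id.
by apply/rowP => j; rewrite mxE ins_lift.
Qed.

End Insertion.

(** * Counting the cubes that meet a graph, from above *)

Section GraphCount.
Context {R : realType}.
Implicit Types (delta : R).

(** Finiteness is kept in the conclusion because [fset_set] sends an infinite set to the empty one,
    which would make [Ngrid] meaningless. *)
Lemma Ngrid_le_card d (A : set 'rV[R]_d) delta (T : finType)
    (psi : T -> {ffun 'I_d -> int}) :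
  grid_cubes A delta `<=` range psi ->
  finite_set (grid_cubes A delta) /\ (Ngrid A delta <= #|T|)%N.
Proof.
move=> sub; have fin : finite_set (grid_cubes A delta).
  by apply: sub_finite_set sub _; apply: finite_image; exact: finite_finset.
split=> //; rewrite /Ngrid cardE -(size_map psi).
apply: uniq_leq_size => [|m]; first exact: fset_uniq.
rewrite in_fset_set // inE => /sub[t _ <-].
by apply: map_f; rewrite mem_enum.
Qed.

(** The offset from [floor u - 1] is nonnegative and less than [r + 2], hence less than
    [Num.trunc r + 3]. *)
Lemma int_offset (u r : R) (m : int) : u - 1 <= m%:~R -> m%:~R <= u + r ->
  exists d : 'I_(Num.trunc r + 3), m = floor u - 1 + d%:Z.
Proof.
move=> um mu; have /andP[fu uf] := floor_itv u.
have D0 : 0 <= m - (floor u - 1).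
  rewrite -(ler_int R) !rmorphB /=; lra.
have tr := truncnS_gt r.
have Dlt : (absz (m - (floor u - 1))%R < Num.trunc r + 3)%N.
  rewrite -ltz_nat gez0_abs // -(ltr_int R) !rmorphB /=.
  by rewrite -pmulrn natrD -natr1 in tr *; rewrite intrD in uf; lra.
by exists (Ordinal Dlt); rewrite /= gez0_abs // addrC subrK.
Qed.

(** A cube is coded by the offset of its base cell and by its vertical offset from a reference value
    of [f] over that cell. Points of a common cell differ by at most [delta] in each coordinate, so
    their values differ by at most [W]. *)
Lemma graph_count n (a b : 'I_n -> R) (f : 'rV[R]_n -> R) (L W delta : R) :
  0 < delta -> 0 <= L -> 0 <= W -> (forall j, b j - a j <= L) ->
  (forall x y, boxQ a b x -> boxQ a b y ->
    (forall j, `|x ord0 j - y ord0 j| <= delta) -> `|f x - f y| <= W) ->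
  finite_set (grid_cubes (graphQ a b f) delta) /\
  (Ngrid (graphQ a b f) delta)%:R <= (L / delta + 3) ^+ n * (2 * W / delta + 3).
Proof.
move=> d0 L0 W0 bL fW.
pose K := (Num.trunc (L / delta) + 3)%N.
pose P := (Num.trunc (2 * W / delta) + 3)%N.
pose base (q : {ffun 'I_n -> 'I_K}) : {ffun 'I_n -> int} :=
  [ffun j => floor (a j / delta) - 1 + (q j)%:Z].
pose cell (m : {ffun 'I_n -> int}) (x : 'rV[R]_n) := boxQ a b x /\
  forall j, (m j)%:~R * delta <= x ord0 j <= (m j + 1)%:~R * delta.
(* The reference point depends on the base cell only, so the code can use it. The default [0] arises
   only for cells that miss the box, and no cube of the graph lies over those. *)
pose pt m := xget 0 (cell m).
pose psi (t : {ffun 'I_n -> 'I_K} * 'I_P) : {ffun 'I_n.+1 -> int} :=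
  ffun_ins (ord_max : 'I_n.+1) (base t.1)
    (floor ((f (pt (base t.1)) - W) / delta) - 1 + t.2%:Z).
have sub : grid_cubes (graphQ a b f) delta `<=` range psi.
  move=> m [p [pQ pf] pm].
  set x := \row_j _ in pQ pf.
  pose m' : {ffun 'I_n -> int} := [ffun j => m (lift ord_max j)].
  have cx : cell m' x.
    by split => // j; rewrite !mxE ffunE; exact: pm.
  have /choice[q qP] : forall j, exists d : 'I_K,
      m' j = floor (a j / delta) - 1 + d%:Z.
    move=> j; have [xQ /(_ j) /andP[mx xm]] := cx.
    have /andP[ax xb] := xQ j; apply: int_offset.
      rewrite lerBlDr -(_ : (m' j + 1)%:~R = (m' j)%:~R + 1); last first.
        by rewrite intrD.
      by rewrite ler_pdivrMr // (le_trans ax).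
    by rewrite -mulrDl ler_pdivlMr //; have := bL j; lra.
  have m'q : base (finfun q) = m'.
    by apply/ffunP => j; rewrite ffunE ffunE -qP.
  have [ptQ ptm] : cell m' (pt m') by apply: xgetPex; exists x.
  have fx : `|f x - f (pt m')| <= W.
    apply: fW => // j; have := ptm j; have := cx.2 j.
    rewrite intrD mulrDl mul1r => /andP[? ?] /andP[? ?].
    by rewrite ler_norml; apply/andP; split; lra.
  have /andP[mp pm'] := pm ord_max; rewrite pf in mp pm'.
  have [l lP] : exists d : 'I_P, m ord_max =
      floor ((f (pt m') - W) / delta) - 1 + d%:Z.
    (* The heights over the cell fill a window of length [2 * W] starting at [f (pt m') - W]. *)
    move: fx; rewrite ler_norml => /andP[fx1 fx2]; apply: int_offset.
      rewrite lerBlDr -(_ : (m ord_max + 1)%:~R = (m ord_max)%:~R + 1).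
        by rewrite ler_pdivrMr //; lra.
      by rewrite intrD.
    by rewrite -mulrDl ler_pdivlMr //; lra.
  by exists (finfun q, l) => //; rewrite /psi /= m'q -lP /m' ffun_ins_eta.
have [fin Nle] := Ngrid_le_card sub.
split => //; apply: le_trans (_ : (#|{: {ffun 'I_n -> 'I_K} * 'I_P}|)%:R <= _).
  by rewrite ler_nat.
rewrite card_prod card_ffun !card_ord natrM natrX.
have Kle : K%:R <= L / delta + 3.
  by rewrite natrD lerD2r truncn_le divr_ge0 // ltW.
have Ple : P%:R <= 2 * W / delta + 3.
  by rewrite natrD lerD2r truncn_le divr_ge0 ?mulr_ge0 // ltW.
apply: ler_pM => //; apply: lerXn2r; rewrite ?nnegrE //.
exact: le_trans Kle.
Qed.

End GraphCount.

(** * Oscillation and one-coordinate moves *)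

Section Oscillation.
Context {R : realType}.
Implicit Types (delta : R).

(** The bound [B] makes [sup] a genuine upper bound; on an unbounded set it would be the default
    [0]. *)
Lemma le_osc (a b : R) (g : R -> R) (B delta x y z : R) :
  (forall t, a <= t <= b -> `|g t| <= B) ->
  a <= y <= b -> x - delta <= y <= x + delta ->
  a <= z <= b -> x - delta <= z <= x + delta ->
  `|g y - g z| <= osc a b g delta x.
Proof.
move=> gB yab yx zab zx; apply: ub_le_sup; last by exists y, z.
exists (B + B) => _ [y' [z' [y'ab _ z'ab _ ->]]].
by rewrite (le_trans (ler_normB _ _)) // lerD // gB.
Qed.

(* [x] is moved to [y] one coordinate at a time. *)
Lemma coordinatewise_bound n (a b : 'I_n -> R) (f : 'rV[R]_n -> R) (E delta : R) :
  (forall i xt s t, boxQi a b i xt -> a i <= s <= b i -> a i <= t <= b i ->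
    `|s - t| <= delta -> `|fsec f i xt s - fsec f i xt t| <= E) ->
  forall x y, boxQ a b x -> boxQ a b y ->
    (forall j, `|x ord0 j - y ord0 j| <= delta) -> `|f x - f y| <= n%:R * E.
Proof.
move=> fE x y xQ yQ xy.
pose mix k : 'rV[R]_n := \row_j if (j < k)%N then y ord0 j else x ord0 j.
have mixQ k : boxQ a b (mix k) by move=> j; rewrite mxE; case: ifP.
have step k : (k <= n)%N -> `|f x - f (mix k)| <= k%:R * E.
  elim: k => [_|k IH kn].
    rewrite (_ : mix 0%N = x) ?subrr ?normr0 ?mul0r //.
    by apply/rowP => j; rewrite mxE.
  pose i := Ordinal kn.
  pose xt : 'rV[R]_n.-1 := \row_l mix k ord0 (lift i l).
  have mk : mix k = ins i xt (x ord0 i).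
    by rewrite -[LHS](ins_eta i) mxE /= ltnn.
  have mk1 : mix k.+1 = ins i xt (y ord0 i).
    rewrite -[LHS](ins_eta i) [X in ins _ _ X]mxE /= ltnSn; congr ins.
    apply/rowP => l; rewrite !mxE ltnS leq_eqVlt.
    by rewrite (_ : (nat_of_ord (lift i l) == k) = false) // eq_sym;
      apply/negbTE; exact: (neq_lift i l).
  have -> : f x - f (mix k.+1) = (f x - f (mix k)) + (f (mix k) - f (mix k.+1)).
    by rewrite addrA subrK.
  rewrite (le_trans (ler_normD _ _)) // -natr1 mulrDl mul1r lerD //.
    exact/IH/ltnW.
  rewrite mk mk1; apply: fE => //.
  by move=> l; rewrite mxE; exact: mixQ.
rewrite -(_ : mix n = y) ?step //.
by apply/rowP => j; rewrite mxE ltn_ord.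
Qed.

End Oscillation.

(** * Bounding the variation by sums of indicators *)

Section VariationCount.
Context {R : realType}.
Implicit Types (delta : R).

(** If the supremum does not exist, [sup] is [0], so the sign is right for every [g]. *)
Lemma osc_ge0 (a b : R) (g : R -> R) delta x : 0 <= osc a b g delta x.
Proof.
rewrite /osc; set S := [set r | _].
have S0 r : S r -> 0 <= r by move=> [y [z [_ _ _ _ ->]]].
have [[[r Sr] Sub]|/sup_out -> //] := pselect (has_sup S).
exact: le_trans (S0 r Sr) (ub_le_sup Sub Sr).
Qed.

(* The integral of a nonnegative function is the supremum of the integrals of
   the simple functions below it, measurable or not. *)
Lemma le_integral_ge0 d (T : measurableType d)
    (mu : {measure set T -> \bar R}) (D : set T) (f g : T -> \bar R) :
  (forall x, D x -> (0 <= f x)%E) -> (forall x, D x -> (f x <= g x)%E) ->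
  (\int[mu]_(x in D) f x <= \int[mu]_(x in D) g x)%E.
Proof.
move=> f0 fg; rewrite !ge0_integralE //; last first.
  by move=> x Dx; exact: le_trans (f0 _ Dx) (fg _ Dx).
apply: ereal_sup_le => _ [h hf <-]; exists h => // x; apply: le_trans (hf x) _.
by rewrite !patchE; case: ifPn => // /set_mem; exact: fg.
Qed.

Lemma Var_le_intervals (a b : R) (g : R -> R) delta (I : Type) (s : seq I)
    (lo : I -> R) (w c : R) : 0 <= c -> 0 <= w ->
  (forall x, a <= x <= b -> osc a b g delta x <=
     \sum_(k <- s) c * \1_(`[lo k, lo k + w]%classic) x) ->
  (Var a b g delta <= ((size s)%:R * (c * w))%:E)%E.
Proof.
move=> c0 w0 le_sum; rewrite /Var.
pose F k x : \bar R := (c * \1_(`[lo k, lo k + w]%classic) x)%:E.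
have F0 k x : (0 <= F k x)%E by rewrite lee_fin mulr_ge0.
apply: (@le_trans _ _ (\int[lebesgue_measure]_(x in `[a, b])
    \sum_(k <- s) F k x)%E).
  apply: le_integral_ge0 => x /=; rewrite in_itv /= => xab.
    by rewrite lee_fin osc_ge0.
  by rewrite sumEFin lee_fin le_sum.
rewrite ge0_integral_sum //; last first.
  by move=> k; apply/measurable_EFinP; exact: measurable_funM.
apply: (@le_trans _ _ (\sum_(k <- s) (c * w)%:E)%E).
  apply: lee_sum => k _; rewrite /F.
  under eq_integral do rewrite EFinM.
  rewrite ge0_integralZl_EFin //; last first.
    by apply/measurable_EFinP; exact: measurable_indic.
  rewrite EFinM lee_wpmul2l ?lee_fin // integral_indic //.
  (* Only the part of the interval inside [[a, b]] is integrated; its measure is at most that of the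
     whole interval. *)
  apply: (@le_trans _ _ (lebesgue_measure `[lo k, lo k + w]%classic)).
    by apply: le_measure; rewrite ?inE //; apply: measurableI.
  rewrite lebesgue_measure_itv /=; case: ifP => _; last by rewrite lee_fin.
  by rewrite -EFinB lee_fin addrC addKr.
by rewrite sumEFin lee_fin big_const_seq count_predT iter_addr_0 mulr_natl.
Qed.

(** By injectivity of [h] each entry of [s] lies in at most one fibre. This adds up the counts over
    distinct transverse cells. *)
Lemma sum_fibers_le (X : Type) (Y : eqType) (T : finType) (s : seq X)
    (r : X -> Y) (h : T -> Y) : injective h ->
  (\sum_q size [seq x <- s | r x == h q] <= size s)%N.
Proof.
move=> hinj; elim: s => [|x s IH]; first by rewrite big1.
have -> : (\sum_q size [seq x0 <- x :: s | r x0 == h q] =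
    \sum_q (r x == h q) + \sum_q size [seq x0 <- s | r x0 == h q])%N.
  by rewrite -big_split; apply: eq_bigr => q _ /=; case: ifP.
rewrite -[size (x :: s)]/(1 + size s)%N leq_add //.
rewrite (eq_bigr (fun q => if r x == h q then 1 else 0)%N); last first.
  by move=> q _; case: (r x == h q).
rewrite -big_mkcond sum1dep_card; apply/card_le1_eqP => p q.
by rewrite !inE => /eqP -> /eqP /hinj.
Qed.
End VariationCount.

(** * The variation of one section against the cubes over its transverse cell *)

Section SectionCubes.
Context {R : realType}.
Variables (n : nat) (a b : 'I_n -> R) (f : 'rV[R]_n -> R) (i : 'I_n).
Variables (xt : 'rV[R]_n.-1) (delta : R) (mt : {ffun 'I_n.-1 -> int}).
Hypothesis delta_gt0 : 0 < delta.
Hypothesis xtQ : boxQi a b i xt.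
Hypothesis xt_mt :
  forall k, (mt k)%:~R * delta <= xt ord0 k <= (mt k + 1)%:~R * delta.

Let g := fsec f i xt.

Hypothesis g_cont : {within `[a i, b i], continuous g}.

Definition transverse (M : {ffun 'I_n.+1 -> int}) : {ffun 'I_n.-1 -> int} :=
  [ffun k => M (lift ord_max (lift i k))].

(** The graph point above [t] lies in this cube. The level [m] is prescribed rather than taken as a
    floor, since a value on a grid level belongs to two closed cubes. *)
Lemma cube_of_section_value (t : R) (m : int) : a i <= t <= b i ->
  m%:~R * delta <= g t <= (m + 1)%:~R * delta ->
  exists M, [/\ grid_cubes (graphQ a b f) delta M, transverse M = mt,
    M (lift ord_max i) = floor (t / delta) & M ord_max = m].
Proof.
move=> tab gtm.
pose m' := ffun_ins i mt (floor (t / delta)).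
exists (ffun_ins (ord_max : 'I_n.+1) m' m); split.
- exists (ins (ord_max : 'I_n.+1) (ins i xt t) (f (ins i xt t))).
    exact/graphQ_ins/boxQ_ins.
  move=> j; case: (unliftP ord_max j) => [j'|] ->; last first.
    by rewrite ffun_ins_id ins_id.
  rewrite ffun_ins_lift ins_lift /m'.
  case: (unliftP i j') => [k|] ->; first by rewrite ffun_ins_lift ins_lift.
  rewrite ffun_ins_id ins_id; have /andP[] := floor_itv (t / delta).
  by rewrite ler_pdivlMr // ltr_pdivrMr // => -> /ltW ->.
- by apply/ffunP => k; rewrite ffunE !ffun_ins_lift.
- by rewrite ffun_ins_lift ffun_ins_id.
- by rewrite ffun_ins_id.
Qed.

(** The order of [y] and [z] is unrelated to that of their values, whence [minr] and [maxr]. *)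
Lemma section_IVT (y z v : R) : a i <= y <= b i -> a i <= z <= b i ->
  g y <= v <= g z -> exists2 t, g t = v & minr y z <= t <= maxr y z.
Proof.
move=> /andP[ay yb] /andP[az zb] /andP[gyv vgz].
have [yz|/ltW zy] := leP y z.
  have [] := @IVT R g y z v yz.
  - apply: continuous_subspaceW g_cont => t /=; rewrite !in_itv /=.
    by move=> /andP[? ?]; apply/andP; split; lra.
  - by rewrite ge_min gyv le_max vgz orbT.
  by move=> t; rewrite in_itv /= => tyz gt; exists t.
have [] := @IVT R g z y v zy.
- apply: continuous_subspaceW g_cont => t /=; rewrite !in_itv /=.
  by move=> /andP[? ?]; apply/andP; split; lra.
- by rewrite ge_min gyv le_max vgz orbT.
by move=> t; rewrite in_itv /= => tyz gt; exists t.
Qed.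

Hypothesis cubes_fin : finite_set (grid_cubes (graphQ a b f) delta).

(** This depends on the transverse cell but not on [xt]: sections picked in different cells count
    disjoint families of cubes. *)
Definition section_cubes : seq {ffun 'I_n.+1 -> int} :=
  [seq M <- fset_set (grid_cubes (graphQ a b f) delta) | transverse M == mt].

(** The [i]-th side of the cube, enlarged by [delta] at both ends, has length [3 * delta]. *)
Let near_cube (x : R) (M : {ffun 'I_n.+1 -> int}) :=
  ((M (lift ord_max i))%:~R - 1) * delta <= x <=
  ((M (lift ord_max i))%:~R - 1) * delta + 3 * delta.

(* By the intermediate value theorem the graph over the [delta]-window around
   [x] meets every grid level between [g y] and [g z]. *)
Lemma section_level_count (x y z : R) :
  a i <= y <= b i -> x - delta <= y <= x + delta ->
  a i <= z <= b i -> x - delta <= z <= x + delta ->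
  g y <= g z ->
  g z - g y <= delta * (size [seq M <- section_cubes | near_cube x M])%:R.
Proof.
move=> yab yx zab zx gyz.
pose p := floor (g y / delta); pose q := floor (g z / delta).
have /andP[py yp] : p%:~R * delta <= g y < (p + 1)%:~R * delta.
  by rewrite -ler_pdivlMr // -ltr_pdivrMr // floor_itv.
have /andP[qz zq] : q%:~R * delta <= g z < (q + 1)%:~R * delta.
  by rewrite -ler_pdivlMr // -ltr_pdivrMr // floor_itv.
have pq : p <= q by apply: le_floor; rewrite ler_pM2r ?invr_gt0.
pose D := absz (q - p)%R.
have qD : q = p + D%:Z by rewrite /D gez0_abs ?subr_ge0 // addrC subrK.
have ex (d : 'I_D.+1) : exists M, [/\ grid_cubes (graphQ a b f) delta M,
    transverse M = mt, near_cube x M & M ord_max = p + d%:Z].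
  have dD : (d%:Z%:~R : R) <= D%:R by rewrite -pmulrn ler_nat -ltnS.
  have d0 : 0 <= (d%:Z%:~R : R) by rewrite -pmulrn.
  (* The bottom of level [p + d], except that for [d = 0] it may lie below [g y]; the maximum keeps
     [v] between [g y] and [g z] and inside the level. *)
  pose v := maxr (g y) ((p + d%:Z)%:~R * delta).
  have [] := @section_IVT y z v yab zab.
    rewrite le_max lexx ge_max gyz /= (le_trans _ qz) // ler_pM2r //.
    by rewrite qD !intrD lerD2l.
  move=> t gt /andP[yt tz].
  have t_in lo hi : lo <= y <= hi -> lo <= z <= hi -> lo <= t <= hi.
    move=> /andP[ly yh] /andP[lz zh].
    by rewrite (le_trans _ yt) ?le_min ?ly // (le_trans tz) // ge_max yh.
  have tab := t_in _ _ yab zab; have tx := t_in _ _ yx zx.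
  have [] := @cube_of_section_value t (p + d%:Z) tab.
    rewrite gt le_max lexx orbT /= ge_max; apply/andP; split.
      apply: le_trans (ltW yp) _; rewrite ler_pM2r // !intrD.
      by rewrite lerD2r lerDl.
    by rewrite ler_pM2r // [X in _ <= X]intrD lerDl.
  move=> M [MG Mt Mi Mm]; exists M; split=> //.
  rewrite /near_cube Mi.
  have /andP[] := floor_itv (t / delta).
  rewrite ler_pdivlMr // ltr_pdivrMr // intrD => f1 f2.
  by case/andP: tx => t1 t2; apply/andP; split; lra.
have [phi phiP] := choice ex.
have phi_inj : injective phi.
  move=> d1 d2 e; apply: val_inj; have [_ _ _ E1] := phiP d1.
  by have [_ _ _] := phiP d2; rewrite -e E1 => /addrI [].
(* The levels [p] to [q] give [D.+1] distinct cubes, while [g z - g y] is less than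
   [(q + 1 - p) * delta]. *)
have le_size : (D.+1 <= size [seq M <- section_cubes | near_cube x M])%N.
  rewrite -[X in (X <= _)%N]card_ord cardE -(size_map phi).
  apply: uniq_leq_size; first by rewrite map_inj_uniq // enum_uniq.
  move=> _ /mapP[d _ ->]; have [MG Mt Mx _] := phiP d.
  by rewrite !mem_filter Mx Mt eqxx in_fset_set // inE.
apply: le_trans (_ : delta * D.+1%:R <= _); last by rewrite ler_pM2l // ler_nat.
move: zq; rewrite qD -natr1 !intrD -[D%:Z%:~R]pmulrn; lra.
Qed.

Lemma osc_le_section_cubes (x : R) : a i <= x <= b i ->
  osc (a i) (b i) g delta x <=
  \sum_(M <- section_cubes) delta *
    \1_(`[((M (lift ord_max i))%:~R - 1) * delta,
          ((M (lift ord_max i))%:~R - 1) * delta + 3 * delta]%classic) x.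
Proof.
move=> xab.
have -> : \sum_(M <- section_cubes) delta *
    \1_(`[((M (lift ord_max i))%:~R - 1) * delta,
          ((M (lift ord_max i))%:~R - 1) * delta + 3 * delta]%classic) x
  = delta * (size [seq M <- section_cubes | near_cube x M])%:R.
  rewrite -mulr_sumr size_filter; congr (_ * _).
  elim: section_cubes => [|M s IH] /=; first by rewrite big_nil.
  by rewrite big_cons IH natrD indicE mem_setE in_itv.
(* Bounding [sup] requires a nonempty set; the pair [x], [x] provides the value [0]. *)
apply: ge_sup.
  exists 0, x, x; rewrite subrr normr0.
  have xx : x - delta <= x <= x + delta by rewrite gerBl lerDl !ltW.
  by split.
move=> _ [y [z [yab yx zab zx ->]]].
have [gyz|/ltW gzy] := leP (g y) (g z).
  by rewrite distrC ger0_norm ?subr_ge0 //; exact: section_level_count.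
by rewrite ger0_norm ?subr_ge0 //; exact: section_level_count.
Qed.

Lemma Var_le_section_cubes :
  (Var (a i) (b i) g delta <=
    ((size section_cubes)%:R * (3 * delta ^+ 2))%:E)%E.
Proof.
rewrite (_ : 3 * delta ^+ 2 = delta * (3 * delta)); last by ring.
apply: Var_le_intervals; [exact: ltW | by rewrite mulr_ge0 // ltW |].
exact: osc_le_section_cubes.
Qed.

End SectionCubes.

(** * Upper and lower dimension bounds for the graph *)

Section GraphDimension.
Context {R : realType}.
Variables (n : nat) (a b : 'I_n -> R) (f : 'rV[R]_n -> R) (H : 'I_n -> R).
Variable B : R.
Hypothesis n_gt0 : (0 < n)%N.
Hypothesis ab : forall i, a i < b i.
Hypothesis H_bnd : forall i, 0 < H i <= 1.
Hypothesis fB : forall x, boxQ a b x -> `|f x| <= B.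

(** The initial value [1] is harmless, since every [H i] is at most [1] and [n] is positive. *)
Let minH := \big[Num.min/1]_(i < n) H i.

Lemma upper_box_dim_graph : osc_upper_hyp a b f H ->
  (upper_box_dim (graphQ a b f) <= (n.+1%:R - minH)%:E)%E.
Proof.
move=> [c [c0 [d0 d0_gt0 osc_le]]].
pose C := \sum_i c i; pose L := \sum_i (b i - a i).
have cC i : c i <= C.
  by rewrite /C (bigD1 i) //= lerDl sumr_ge0 // => j _; exact: ltW.
have bL i : b i - a i <= L.
  by rewrite /L (bigD1 i) //= lerDl sumr_ge0 // => j _; rewrite subr_ge0 ltW.
have C0 : 0 <= C by apply: sumr_ge0 => j _; exact: ltW.
have L0 : 0 <= L by apply: sumr_ge0 => j _; rewrite subr_ge0 ltW.
have h1 : minH <= 1 by exact: bigmin_le_id.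
have n0 : 0 <= n%:R :> R by exact: ler0n.
(* The constant is that of [graph_count] with [W = n * C * delta ^ minH], where [delta < 1] lets
   both summands [3] be absorbed. *)
apply: (@upper_box_dim_le _ _ _ _ ((L + 3) ^+ n * (2 * n%:R * C + 3))).
- by rewrite -natr1; lra.
- by apply: mulr_gt0; [apply: exprn_gt0; lra | rewrite ltr_wpDl // !mulr_ge0].
near=> delta.
have dgt0 : 0 < delta by near: delta; exact: nbhs_right_gt.
have dlt1 : delta < 1 by near: delta; exact: nbhs_right_lt.
have dltd0 : delta < d0 by near: delta; exact: nbhs_right_lt.
have d01 : 0 < delta <= 1 by rewrite dgt0 ltW.
have fE i xt s t : boxQi a b i xt -> a i <= s <= b i -> a i <= t <= b i ->
    `|s - t| <= delta -> `|fsec f i xt s - fsec f i xt t| <= C * delta `^ minH.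
  move=> xtQ sab tab; rewrite ler_norml => /andP[st1 st2].
  apply: le_trans (_ : osc (a i) (b i) (fsec f i xt) delta s <= _).
    apply: (@le_osc _ _ _ _ B) => //.
    - by move=> u uab; apply: fB; exact: boxQ_ins.
    - by apply/andP; split; lra.
    - by apply/andP; split; lra.
  apply: le_trans (osc_le _ _ _ _ xtQ sab _) _; first by rewrite dgt0.
  apply: ler_pM => //; [exact: ltW | exact: powR_ge0 |].
  by apply: ger_powR => //; exact: bigmin_le.
have E0 : 0 <= n%:R * (C * delta `^ minH).
  by rewrite !mulr_ge0 // powR_ge0.
have [_] := graph_count dgt0 L0 E0 bL (coordinatewise_bound fE).
move=> /le_trans; apply.
have -> : - (n.+1%:R - minH) = (minH - 1) + - n%:R by rewrite -natr1; ring.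
rewrite powRD ?(gt_eqF dgt0) ?implybT // powRN powR_mulrn ?(ltW dgt0) //.
(* As [minH <= 1], this power dominates [1] and absorbs the [3] of the vertical count. *)
have p1 : 1 <= delta `^ (minH - 1).
  by rewrite -[X in X <= _](powRr0 delta); apply: ger_powR => //; lra.
have -> : (L + 3) ^+ n * (2 * n%:R * C + 3) *
    (delta `^ (minH - 1) * (delta ^+ n)^-1) =
    ((L + 3) / delta) ^+ n * ((2 * n%:R * C + 3) * delta `^ (minH - 1)).
  by rewrite expr_div_n; ring.
have q0 : 0 <= L / delta by rewrite divr_ge0 // ltW.
have e0 : 0 <= 2 * (n%:R * (C * delta `^ minH)) / delta.
  by rewrite !mulr_ge0 // ?powR_ge0 // invr_ge0 ltW.
apply: ler_pM.
- by apply: exprn_ge0; lra.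
- by lra.
- apply: lerXn2r; rewrite ?nnegrE; first by lra.
    by rewrite divr_ge0 ?ltW //; lra.
  rewrite mulrDl lerD2l ler_pdivlMr // -[X in _ <= X]mulr1 ler_pM2l //.
  exact: ltW.
- have -> : delta `^ (minH - 1) = delta `^ minH / delta.
    rewrite powRD ?(gt_eqF dgt0) ?implybT // powRN powRr1 // ltW.
  have p1' : 1 <= delta `^ minH / delta.
    move: p1; rewrite powRD ?(gt_eqF dgt0) ?implybT // powRN powRr1 // ltW.
  by lra.
Unshelve. all: by end_near. Qed.

Hypothesis f_cont : forall i xt, boxQi a b i xt ->
  {within `[a i, b i], continuous (fsec f i xt)}.

(** The crude bound [2 * |B|] on differences of values already suffices for [graph_count]. *)
Lemma cubes_finite delta : 0 < delta ->
  finite_set (grid_cubes (graphQ a b f) delta).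
Proof.
move=> d0.
have L0 : 0 <= \sum_i (b i - a i).
  by apply: sumr_ge0 => j _; rewrite subr_ge0 ltW.
have bL i : b i - a i <= \sum_i (b i - a i).
  by rewrite (bigD1 i) //= lerDl sumr_ge0 // => j _; rewrite subr_ge0 ltW.
have W0 : 0 <= `|B| + `|B| by rewrite addr_ge0.
apply: (graph_count d0 L0 W0 bL _).1 => x y xQ yQ _.
rewrite (le_trans (ler_normB _ _)) // lerD //.
  exact: le_trans (fB xQ) (ler_norm _).
exact: le_trans (fB yQ) (ler_norm _).
Qed.

(** Stated for a single direction, so as to serve both the direction of smallest exponent and the
    one-dimensional sections. *)
Lemma lower_box_dim_graph_coord i (A : set 'rV[R]_n.-1) (c d0 : R) :
  dense_in A (boxQi a b i) -> 0 < c -> 0 < d0 ->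
  (forall xt delta, A xt -> 0 < delta < d0 ->
    ((c * delta `^ H i)%:E <= Var (a i) (b i) (fsec f i xt) delta)%E) ->
  ((n.+1%:R - H i)%:E <= lower_box_dim (graphQ a b f))%E.
Proof.
move=> [AQ QA] c0 d0_gt0 var_ge.
pose L := \big[Num.min/1]_j (b j - a j).
have L0 : 0 < L by apply: lt_bigmin => // j _; rewrite subr_gt0.
have Lb j : L <= b j - a j by exact: bigmin_le.
(* There are at least [L / 4 / delta] usable cells in each of [n.-1] directions, and each transverse
   cell yields [c / 3 * delta ^ (H i - 2)] cubes. *)
apply: (@lower_box_dim_ge _ _ _ _ ((L / 4) ^+ n.-1 * (c / 3))).
  by rewrite mulr_gt0 ?exprn_gt0 ?divr_gt0.
near=> delta.
have dgt0 : 0 < delta by near: delta; exact: nbhs_right_gt.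
have dltd0 : delta < d0 by near: delta; exact: nbhs_right_lt.
have dltL : delta < L / 4 by near: delta; apply: nbhs_right_lt; lra.
pose P := Num.trunc (L / 2 / delta).
have Lq0 : 0 <= L / 2 / delta by rewrite !divr_ge0 // ltW.
have PL : P%:R * delta <= L / 2 by rewrite -ler_pdivlMr // truncn_le.
have PgeL : L / 4 / delta <= P%:R.
  have := truncnS_gt (L / 2 / delta); rewrite -natr1 -/P.
  have -> : L / 2 / delta = 2 * (L / 4 / delta) by field; rewrite gt_eqF.
  have : 1 <= L / 4 / delta by rewrite ler_pdivlMr // mul1r ltW.
  by lra.
(* The [+ 1] starts to the right of the left endpoint; [P * delta <= L / 2] and [delta < L / 4] keep
   these cells inside the box. *)
pose base (q : {ffun 'I_n.-1 -> 'I_P}) : {ffun 'I_n.-1 -> int} :=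
  [ffun k => floor (a (lift i k) / delta) + 1 + (q k)%:Z].
have base_inj : injective base.
  move=> q1 q2 /ffunP e; apply/ffunP => k; apply: val_inj.
  by have := e k; rewrite !ffunE => /addrI [].
have pts q : exists xt, A xt /\ forall k,
    (base q k)%:~R * delta <= xt ord0 k <= (base q k + 1)%:~R * delta.
  (* The centre of the cell: its [delta / 2] ball for the sup norm stays in the cell, and density
     puts a point of [A] there. *)
  pose y : 'rV[R]_n.-1 := \row_k (((base q k)%:~R + 1 / 2) * delta).
  have yQ : boxQi a b i y.
    move=> k; rewrite mxE ffunE !intrD -[(_%:Z)%:~R]pmulrn.
    have /andP[] := floor_itv (a (lift i k) / delta).
    rewrite intrD ler_pdivlMr // ltr_pdivrMr // => f1 f2.
    have q0 : 0 <= (q k)%:R * delta by rewrite mulr_ge0 // ltW.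
    have qP : (q k)%:R * delta + delta <= P%:R * delta.
      by rewrite -[X in _ + X]mul1r -mulrDl ler_pM2r // natr1 ler_nat.
    by have := Lb (lift i k) => Lk; apply/andP; split; lra.
  have [] := QA y yQ (ball y (delta / 2)).
    by apply: nbhsx_ballx; rewrite divr_gt0.
  move=> xt [Axt [_ yxt]]; exists xt; split => // k.
  have := yxt ord0 k; rewrite /ball /= mxE ltr_norml => /andP[f1 f2].
  by rewrite intrD; apply/andP; split; lra.
have [xs xsP] := choice pts.
have fin := cubes_finite dgt0.
have cell_ge q : c * delta `^ H i / (3 * delta ^+ 2) <=
    (size (section_cubes a b f i delta (base q)))%:R.
  rewrite ler_pdivrMr ?mulr_gt0 ?exprn_gt0 // -lee_fin.
  have [Ax xm] := xsP q; apply: le_trans (var_ge _ delta Ax _) _.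
    by rewrite dgt0.
  by apply: Var_le_section_cubes => //; [exact: AQ | apply/f_cont/AQ].
apply: le_trans (_ : \sum_(q : {ffun 'I_n.-1 -> 'I_P})
    c * delta `^ H i / (3 * delta ^+ 2) <= _); last first.
  apply: le_trans (ler_sum _ (fun q _ => cell_ge q)) _.
  by rewrite -natr_sum ler_nat; exact: sum_fibers_le.
rewrite sumr_const card_ffun !card_ord -[X in _ <= X]mulr_natl natrX.
have -> : - (n.+1%:R - H i) = H i + - 2 + - n.-1%:R.
  by rewrite -[in LHS](prednK n_gt0) -natr1 -[_.+1%:R]natr1; ring.
rewrite !powRD ?(gt_eqF dgt0) ?implybT // !powRN !powR_mulrn ?(ltW dgt0) //.
have -> : (L / 4) ^+ n.-1 * (c / 3) *
    (delta `^ H i * (delta ^+ 2)^-1 * (delta ^+ n.-1)^-1) =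
    (L / 4 / delta) ^+ n.-1 * (c * delta `^ H i / (3 * delta ^+ 2)).
  rewrite [in RHS]expr_div_n.
  have : delta ^+ n.-1 != 0 by rewrite expf_neq0 // gt_eqF.
  move: (_ ^+ n.-1) (delta ^+ n.-1) => X Y Y0; field.
  by rewrite Y0 gt_eqF.
apply: ler_wpM2r.
  by rewrite !mulr_ge0 ?invr_ge0 ?mulr_ge0 ?powR_ge0 ?exprn_ge0 ?ltW.
apply: lerXn2r; rewrite ?nnegrE //.
by rewrite !divr_ge0 // ltW.
Unshelve. all: by end_near. Qed.

(** The minimum is attained at some [i], and that one direction gives the bound. *)
Lemma lower_box_dim_graph : var_lower_hyp a b f H ->
  ((n.+1%:R - minH)%:E <= lower_box_dim (graphQ a b f))%E.
Proof.
move=> var_ge; have H1 (j : 'I_n) : true -> H j <= 1 by case/andP: (H_bnd j).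
rewrite /minH; have [i _ ->] := @eq_bigmin _ _ _ 1 (Ordinal n_gt0) xpredT H isT H1.
have [A [Ad [c c0 [d0 d0_gt0 Av]]]] := var_ge i.
exact: lower_box_dim_graph_coord Ad c0 d0_gt0 Av.
Qed.

End GraphDimension.

(** * Boundedness of [f] and continuity of its sections *)

Section SectionRegularity.
Context {R : realType}.
Variables (n : nat) (a b : 'I_n -> R) (f : 'rV[R]_n -> R).
Hypothesis f_cont : {within boxQ a b, continuous f}.

Lemma boxQ_compact : compact (boxQ a b).
Proof.
have := @rV_compact R n (fun j => `[a j, b j]%classic)
  (fun j => @segment_compact R (a j) (b j)).
congr compact; apply/seteqP; split=> v vQ j; have := vQ j;
  by rewrite /= in_itv.
Qed.

Lemma continuous_boxQ_bounded :
  exists B, forall x, boxQ a b x -> `|f x| <= B.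
Proof.
have [M [_ fM]] := compact_bounded (continuous_compact f_cont boxQ_compact).
by exists (M + 1) => x xQ; apply: fM; [rewrite ltrDl | exists x].
Qed.

(** Insertion changes only coordinate [i], so it maps a ball into a ball of the same radius. *)
Lemma fsec_continuous i xt : boxQi a b i xt ->
  {within `[a i, b i], continuous (fsec f i xt)}.
Proof.
move=> xtQ; apply/subspace_continuousP => t /=; rewrite in_itv /= => tab.
have insQ := boxQ_ins xtQ tab.
have /subspace_continuousP/(_ _ insQ) f_at := f_cont.
apply: cvg_trans f_at; rewrite /fsec => U /= fU.
have [e /= e0 eU] := (nbhs_ballP _ _).1 fU.
apply/nbhs_ballP; exists e => //= s ts; rewrite in_itv /= => sab.
apply: eU; last exact: boxQ_ins.
split=> // j k; rewrite (ord1 j) !mxE.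
by case: unliftP => [l|] _ //; exact: ballxx.
Qed.

End SectionRegularity.

(** * Dimensions of the sections *)

Section Sections.
Context {R : realType}.
Variables (n : nat) (a b : 'I_n -> R) (f : 'rV[R]_n -> R) (H : 'I_n -> R).
Hypothesis ab : forall i, a i < b i.
Hypothesis f_cont : {within boxQ a b, continuous f}.
Hypothesis H_bnd : forall i, 0 < H i <= 1.

(** This turns a section into a function on a one-dimensional box, where the graph bounds apply with
    [n = 1]. *)
Let lift1 (g : R -> R) (x : 'rV[R]_1) := g (x ord0 ord0).

Lemma graph1E (lo hi : R) (g : R -> R) :
  graph1 lo hi g = graphQ (fun=> lo) (fun=> hi) (lift1 g).
Proof.
have e : lift ord_max (ord0 : 'I_1) = ord0 :> 'I_2 by exact: val_inj.
apply/seteqP; split=> p.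
  move=> [pQ pg]; split; last by rewrite /lift1 mxE e.
  by move=> j; rewrite mxE (ord1 j) e.
move=> [pQ pg]; split; first by have := pQ ord0; rewrite mxE e.
by move: pg; rewrite /lift1 mxE e.
Qed.

Lemma fsec_lift1 g (i : 'I_1) xt : fsec (lift1 g) i xt = g.
Proof. by apply/funext => t; rewrite /fsec /lift1 (ord1 i) ins_id. Qed.

Lemma bigmin1 (h : R) : h <= 1 -> \big[Num.min/1]_(j < 1) h = h.
Proof. by move=> h1; rewrite big_ord_recl big_ord0 min_l. Qed.

Lemma lift1_bounded i xt : boxQi a b i xt ->
  exists B, forall x, boxQ (fun=> a i) (fun=> b i) x ->
    `|lift1 (fsec f i xt) x| <= B.
Proof.
move=> xtQ; have [B fB] := continuous_boxQ_bounded f_cont.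
by exists B => x xQ; apply/fB/boxQ_ins => //; exact: xQ.
Qed.

Lemma upper_box_dim_section i xt : osc_upper_hyp a b f H -> boxQi a b i xt ->
  (upper_box_dim (graph1 (a i) (b i) (fsec f i xt)) <= (2 - H i)%:E)%E.
Proof.
move=> [c [c0 [d0 d0_gt0 osc_le]]] xtQ; have [B fB] := lift1_bounded xtQ.
have /andP[_ H1] := H_bnd i.
rewrite graph1E -(bigmin1 H1).
apply: (upper_box_dim_graph (B := B)) => //.
exists (fun=> c i); split=> //; exists d0 => // j yt t delta _ tab dd.
by rewrite fsec_lift1; exact: osc_le.
Qed.

Lemma lower_box_dim_section i xt c d0 : boxQi a b i xt -> 0 < c -> 0 < d0 ->
  (forall delta, 0 < delta < d0 ->
    ((c * delta `^ H i)%:E <= Var (a i) (b i) (fsec f i xt) delta)%E) ->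
  ((2 - H i)%:E <= lower_box_dim (graph1 (a i) (b i) (fsec f i xt)))%E.
Proof.
move=> xtQ c0 d0_gt0 var_ge; have [B fB] := lift1_bounded xtQ.
rewrite graph1E.
(* Transverse points are empty rows here, so the whole transverse box serves as the dense set. *)
apply: (@lower_box_dim_graph_coord _ 1 (fun=> a i) (fun=> b i)
  (lift1 (fsec f i xt)) (fun=> H i) B _ _ fB _ ord0
  (boxQi (fun=> a i) (fun=> b i) ord0) c d0) => //.
- by move=> j yt _; rewrite fsec_lift1; exact: fsec_continuous.
- by split => //; exact: subset_closure.
- by move=> yt delta _ dd; rewrite fsec_lift1; exact: var_ge.
Qed.

Lemma s_secE i : osc_upper_hyp a b f H -> var_lower_hyp a b f H ->
  s_sec a b f i = (2 - H i)%:E.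
Proof.
move=> osc_le var_ge; apply/le_anti/andP; split.
  by apply: ge_ereal_sup => _ [xt [xtQ _] <-]; exact: upper_box_dim_section.
have [A [[AQ QA] [c c0 [d0 d0_gt0 Av]]]] := var_ge i.
(* The corner of the transverse box is in the closure of [A], so [A] has a point. *)
have [xt [Axt _]] : A `&` setT !=set0.
  apply: (QA (\row_k a (lift i k))); last exact: filterT.
  by move=> k; rewrite mxE lexx ltW.
have xtQ := AQ _ Axt.
have up := upper_box_dim_section osc_le xtQ.
have low := lower_box_dim_section xtQ c0 d0_gt0
  (fun delta => @Av xt delta Axt).
have mid : (lower_box_dim (graph1 (a i) (b i) (fsec f i xt)) <=
    upper_box_dim (graph1 (a i) (b i) (fsec f i xt)))%E.
  exact: limf_einf_le_esup.
apply: (le_trans (le_trans low mid)).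
apply: ereal_sup_ubound; exists xt => //; split => //.
by apply/le_anti; rewrite mid (le_trans up low).
Qed.

End Sections.

Theorem mainTheorem7 (R : realType) (n : nat) (a b : 'I_n -> R)
  (f : 'rV[R]_n -> R) (H : 'I_n -> R) :
  (0 < n)%N ->
  (forall i, a i < b i) ->
  {within boxQ a b, continuous f} ->
  (forall i, 0 < H i <= 1) ->
  let minH := \big[Num.min/1]_(i < n) H i in
  (* (1) *)
  (osc_upper_hyp a b f H ->
     (upper_box_dim (graphQ a b f) <= (n.+1%:R - minH)%:E)%E) /\
  (* (2) *)
  (var_lower_hyp a b f H ->
     ((n.+1%:R - minH)%:E <= lower_box_dim (graphQ a b f))%E) /\
  (* (3) *)
  (osc_upper_hyp a b f H -> var_lower_hyp a b f H ->
     [/\ box_dim_exists (graphQ a b f),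
         upper_box_dim (graphQ a b f) = (n.+1%:R - minH)%:E &
         (n.+1%:R - minH)%:E =
           ((n%:R - 1)%:E + \big[maxe/-oo]_(i < n) s_sec a b f i)%E]).
Proof.
move=> n_gt0 ab f_cont H_bnd minH.
have [B fB] := continuous_boxQ_bounded f_cont.
have sec_cont := fsec_continuous f_cont.
have part1 : osc_upper_hyp a b f H ->
    (upper_box_dim (graphQ a b f) <= (n.+1%:R - minH)%:E)%E.
  exact: (upper_box_dim_graph (B := B)).
have part2 : var_lower_hyp a b f H ->
    ((n.+1%:R - minH)%:E <= lower_box_dim (graphQ a b f))%E.
  exact: (lower_box_dim_graph (B := B)).
split => //; split => // osc_le var_ge.
have up := part1 osc_le; have low := part2 var_ge.
have mid : (lower_box_dim (graphQ a b f) <= upper_box_dim (graphQ a b f))%E.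
  exact: limf_einf_le_esup.
split.
- by apply/le_anti; rewrite mid (le_trans up low).
- by apply/le_anti; rewrite up (le_trans low mid).
under eq_bigr => i _ do rewrite (s_secE ab f_cont H_bnd i osc_le var_ge).
(* The index attaining the minimum of [H] attains this maximum; then [n - 1 + 2 = n + 1]. *)
have -> : \big[maxe/-oo%E]_(i < n) (2 - H i)%:E = (2 - minH)%:E.
  apply/le_anti/andP; split.
    apply: bigmax_le => [|i _]; first exact: leNye.
    by rewrite lee_fin lerD2l lerN2; exact: bigmin_le.
  have H1 (j : 'I_n) : true -> H j <= 1 by case/andP: (H_bnd j).
  rewrite /minH; have [i _ ->] := @eq_bigmin _ _ _ 1 (Ordinal n_gt0) xpredT H isT H1.
  exact: (le_bigmax _ (fun i => (2 - H i)%:E)).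
by rewrite -EFinD -natr1; congr EFin; ring.
Qed.
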